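(* Let $I$ be a monomial ideal in $R=K[x_1,\ldots,x_n]$ and let $<$ be a total order on $G(I)$. Then the following statements are equivalent: (i) The Lyubeznik resolution $\mathcal{L}_{\bullet(I,<)}$ of $I$ with respect to $<$ is a minimal free resolution. (ii) For every element $u$ of $G(I)$ and every cover $C$ of $u$, $C$ is not preserved. (iii) For every element $u$ of $G(I)$ and every cover $C$ of $u$, there exist $D\subseteq C$ and $v\in G(I)$ with $v\notin D$, such that $D\cup\{v\}$ is a cover of $v$ and $\min(\overline{D}-D)<\min(D)$. (iv) For every element $u$ of $G(I)$ and every $E$-minimal cover $C$ of $u$, $C$ is not preserved. (v) For every element $u$ of $G(I)$ and every $E$-minimal cover $C$ of $u$, there exist $D\subseteq C$ and $v\in G(I)$ with $v\notin D$, such that $D\cup\{v\}$ is an $E$-minimal cover of $v$ and $\min(\overline{D}-D)<\min(D)$.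
   Context: $K$ is a field and $G(I)$ denotes the minimal set of monomial generators of $I$, written $G(I)=\{m_1<\cdots<m_\mu\}$ in increasing order for the given total order $<$ (an arbitrary total order on the set $G(I)$). For $A\subseteq G(I)$, $\mathrm{lcm}(A)$ is the least common multiple of the elements of $A$ and $\min(A)$ is its least element under $<$. Covers: a subset $C\subseteq G(I)$ is a cover of $u\in C$ if $u\mid\mathrm{lcm}(C-\{u\})$. A cover $C$ of $u$ is an $E$-minimal cover of $u$ if no proper subset of $C$ is a cover of $u$. For $D\subseteq G(I)$, $\overline{D}=\{w\in G(I): w\mid\mathrm{lcm}(D)\}$. Preserved sets: a (nonempty) subset $D\subseteq G(I)$ is broken (under $<$) if there is $u\in G(I)$ with $u\mid\mathrm{lcm}(D)$ and $u<\min(D)$. A subset $E\subseteq G(I)$ is preserved if no subset of $E$ is broken. Lyubeznik resolution: a symbol is $u(i_1;\ldots;i_t)$ with $1\le i_1<\cdots<i_t\le\mu$; it is $L$-admissible (of dimension $t$) if for all $h<t$ and all $q<i_h$, $m_q$ does not divide $\mathrm{lcm}(m_{i_h},\ldots,m_{i_t})$. $\mathcal{L}_{\bullet(I,<)}$ is the free resolution of $R/I$ with $L^0=R$, $L^t$ the free $R$-module on the $L$-admissible symbols of dimension $t$, and $$\partial_t(u(i_1;\ldots;i_t))=\sum_{j=1}^t(-1)^{j+1}\frac{\mathrm{lcm}(m_{i_1},\ldots,m_{i_t})}{\mathrm{lcm}(m_{i_1},\ldots,\widehat{m_{i_j}},\ldots,m_{i_t})}\,u(i_1;\ldots;\widehat{i_j};\ldots;i_t).$$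 It is minimal if $\partial_t(L^t)\subseteq\langle x_1,\ldots,x_n\rangle L^{t-1}$ for all $t$. *)

(* Defs.v *)
From HB Require Import structures.
From mathcomp Require Import all_boot all_order all_algebra.
From mathcomp Require Import finmap mpoly.

Set Implicit Arguments.
Unset Strict Implicit.
Unset Printing Implicit Defensive.

Import GRing.Theory.
Local Open Scope ring_scope.

(** Divisibility of monomials is the componentwise order [(m1 <= m2)%MM] on
    exponent vectors. Ideals of [{mpoly K[n]}] are predicates into [Prop]. *)

Lemma mlcmA (n : nat) : associative (@mlcm n).
Proof. by move=> a b c; apply/mnmP=> i; rewrite !mnmE maxnA. Qed.

HB.instance Definition _ (n : nat) :=
  Monoid.isComLaw.Build 'X_{1..n} 0%MM (@mlcm n)
    (@mlcmA n) (@mlcmC n) (@mlc0m n).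

Section Ideals.
Variable R : comNzRingType.

Definition ideal_gen (S : R -> Prop) (f : R) : Prop :=
  exists (N : nat) (c a : 'I_N -> R),
    (forall i, S (a i)) /\ f = \sum_(i < N) c i * a i.

(* The submodule J M of a module M. *)
Definition ideal_smul (M : lmodType R) (J : R -> Prop) (w : M) : Prop :=
  exists (N : nat) (a : 'I_N -> R) (v : 'I_N -> M),
    (forall i, J (a i)) /\ w = \sum_(i < N) a i *: v i.

End Ideals.

Section MonomialIdeals.
Variables (K : fieldType) (n : nat).

Definition mon_ideal_gen (S : 'X_{1..n} -> Prop) : {mpoly K[n]} -> Prop :=
  ideal_gen (fun g => exists2 m, S m & g = 'X_[m]).

Definition monomial_ideal (I : {mpoly K[n]} -> Prop) : Prop :=
  exists S : 'X_{1..n} -> Prop, forall f, I f <-> mon_ideal_gen S f.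

Definition mon_generators (I : {mpoly K[n]} -> Prop) (G : {fset 'X_{1..n}}) :
    Prop :=
  forall f, I f <-> mon_ideal_gen (fun m => m \in G) f.

Definition minimal_mon_generators (I : {mpoly K[n]} -> Prop)
    (G : {fset 'X_{1..n}}) : Prop :=
  mon_generators I G /\
  (forall G' : {fset 'X_{1..n}}, (G' `<` G)%fset -> ~ mon_generators I G').

Definition irrelevant_ideal : {mpoly K[n]} -> Prop :=
  ideal_gen (fun g => exists k : 'I_n, g = 'X_k).

End MonomialIdeals.

Definition strict_total_order (T : eqType) (lt : rel T) : Prop :=
  [/\ irreflexive lt, transitive lt &
      forall x y, x != y -> lt x y || lt y x].

Section Covers.
Variables (n : nat) (G : {fset 'X_{1..n}}) (lt : rel G).
Implicit Types (u v w : G) (A B C D E : {set G}).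

Definition lcm_set A : 'X_{1..n} :=
  \big[@mlcm n / 0%MM]_(u in A) val u.

Definition is_cover u C : Prop :=
  u \in C /\ (val u <= lcm_set (C :\ u))%MM.

Definition E_minimal_cover u C : Prop :=
  is_cover u C /\ (forall C' : {set G}, C' \proper C -> ~ is_cover u C').

Definition lcm_closure D : {set G} :=
  [set w : G | (val w <= lcm_set D)%MM].

Definition is_min A u : Prop :=
  u \in A /\ (forall v, v \in A -> v != u -> lt u v).

(* [min A < min B]; false when one of the two sets is empty. *)
Definition min_lt A B : Prop :=
  exists u v, [/\ is_min A u, is_min B v & lt u v].

(* The existence of [min D] forces [D] to be nonempty. *)
Definition broken D : Prop :=
  exists u v, [/\ (val u <= lcm_set D)%MM, is_min D v & lt u v].

Definition preserved E : Prop :=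
  forall D, D \subset E -> ~ broken D.

End Covers.

(* [ord_gen lt i] is the element m_(i+1) of G = {m_1 < ... < m_mu}. *)
Definition ord_gen (n : nat) (G : {fset 'X_{1..n}}) (lt : rel G)
    (i : 'I_#|{: G}|) : 'X_{1..n} :=
  val (tnth (sort_tuple (fun u v => (u == v) || lt u v) (enum_tuple {: G})) i).

Section Lyubeznik.
Variables (K : fieldType) (n mu : nat) (m : 'I_mu -> 'X_{1..n}).

(* lcm(m_{i_h}, ..., m_{i_t}), where h is counted from 0. *)
Definition lcm_from (t : nat) (s : t.-tuple 'I_mu) (h : nat) : 'X_{1..n} :=
  \big[@mlcm n / 0%MM]_(k < t | (h <= k)%N) m (tnth s k).

Definition L_admissible (t : nat) (s : t.-tuple 'I_mu) : bool :=
  [forall i : 'I_t, forall j : 'I_t,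
     (i < j)%N ==> (tnth s i < tnth s j)%N] &&
  [forall h : 'I_t, forall q : 'I_mu,
     (h.+1 < t)%N && (q < tnth s h)%N ==> ~~ (m q <= lcm_from s h)%MM].

Definition del (t : nat) (j : 'I_t.+1) (s : t.+1.-tuple 'I_mu) :
    t.-tuple 'I_mu :=
  [tuple tnth s (lift j i) | i < t].

Lemma lcm_from_del t j (s : t.+1.-tuple 'I_mu) (h : 'I_t) :
  (lcm_from (del j s) h <= lcm_from s (lift j h))%MM.
Proof.
rewrite /lcm_from.
elim/big_ind: _ => [|x y lex ley|k lehk].
- by apply/mnm_lepP=> i; rewrite mnmE.
- by rewrite lem_mlcm lex ley.
rewrite tnth_mktuple (bigD1 (lift j k)) /= ?lem_mlcml //.
by rewrite leq_bump2.
Qed.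

Lemma L_admissible_del t j (s : t.+1.-tuple 'I_mu) :
  L_admissible s -> L_admissible (del j s).
Proof.
case/andP=> /forallP incr /forallP adm; apply/andP; split.
  apply/forallP=> i; apply/forallP=> k; apply/implyP=> ltik.
  rewrite !tnth_mktuple.
  have /implyP := forallP (incr (lift j i)) (lift j k); apply.
  by rewrite ltnNge leq_bump2 -ltnNge.
apply/forallP=> h; apply/forallP=> q; apply/implyP=> /andP[lth].
rewrite tnth_mktuple => ltq.
have /implyP := forallP (adm (lift j h)) q.
have -> : ((lift j h).+1 < t.+1)%N.
  by rewrite ltnS; apply: leq_ltn_trans lth; rewrite /= /bump; case: (j <= h)%N.
move=> /(_ ltq); apply: contra => /lepm_trans; apply; exact: lcm_from_del.
Qed.

Definition L_symbol (t : nat) := {s : t.-tuple 'I_mu | L_admissible s}.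

Definition del_symbol (t : nat) (j : 'I_t.+1) (s : L_symbol t.+1) :
    L_symbol t :=
  exist _ (del j (val s)) (L_admissible_del j (valP s)).

Definition L_module (t : nat) := {ffun L_symbol t -> {mpoly K[n]}^o}.

Definition L_basis (t : nat) (s : L_symbol t) : L_module t :=
  [ffun s' => (s' == s)%:R].

(* Since j is counted from 0, the sign (-1)^(j+1) becomes (-1)^j; the
   coefficient is the quotient of the two lcm's. *)
Definition L_diff_symbol (t : nat) (s : L_symbol t.+1) : L_module t :=
  \sum_(j < t.+1)
    ((-1) ^+ j *
       'X_[lcm_from (val s) 0 - lcm_from (val (del_symbol j s)) 0])
      *: L_basis (del_symbol j s).

Definition L_diff (t : nat) (f : L_module t.+1) : L_module t :=
  \sum_(s : L_symbol t.+1) f s *: L_diff_symbol s.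

Lemma L_admissible_nil : L_admissible [tuple].
Proof. by apply/andP; split; apply/forallP; case. Qed.

Definition nil_symbol : L_symbol 0 := exist _ [tuple] L_admissible_nil.

(* [nil_symbol] is the only symbol of dimension 0, so [f |-> f nil_symbol]
   identifies [L_module 0] with the polynomial ring, and exactness of
   L^1 -> L^0 -> R/I -> 0 says that the image of [L_diff] is I. *)
Definition L_resolves (I : {mpoly K[n]} -> Prop) : Prop :=
  (forall f : L_module 0,
     (exists g : L_module 1, L_diff g = f) <-> I (f nil_symbol)) /\
  (forall (t : nat) (f : L_module t.+1),
     (exists g : L_module t.+2, L_diff g = f) <-> L_diff f = 0).

Definition L_minimal : Prop :=
  forall (t : nat) (f : L_module t.+1),
    ideal_smul (@irrelevant_ideal K n) (L_diff f).

Definition L_minimal_free_resolution (I : {mpoly K[n]} -> Prop) : Prop :=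
  L_resolves I /\ L_minimal.

End Lyubeznik.

(* Main.v *)
From HB Require Import structures.
Require Import Defs.
From mathcomp Require Import all_boot all_order all_algebra.
From mathcomp Require Import finmap ssrcomplements mpoly.
From Stdlib Require Import Classical_Prop.

Set Implicit Arguments.
Unset Strict Implicit.
Unset Printing Implicit Defensive.

Import GRing.Theory.
Local Open Scope ring_scope.

(** Two facts carry the theorem.

    The first is that the Lyubeznik complex always resolves [R/I], so that (i)
    is a statement about minimality alone. The complex is multigraded: for an
    admissible symbol [s] and a monomial [x] divisible by [lcm s], the element
    [homog_elt x s], namely [x / lcm s] times the basis element of [s], has
    multidegree [x], and the differential sends it to the alternating sum of
    the [homog_elt x (del j s)]. In a fixed multidegree [x] the complex is thus
    the augmented chain complex of the simplicial complex of admissible symbols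
    whose lcm divides [x]. If some generator divides [x], this simplicial
    complex is a cone with apex the least such generator [q]: every
    index in a symbol whose lcm divides [x] is at least [q], and prepending [q]
    keeps a symbol admissible by minimality of [q]. Prepending [q] is therefore
    a contracting homotopy ([cone_homotopy]), whence exactness in positive
    degrees; in degree 0 the image is the ideal spanned by the generators
    ([Lyubeznik_resolves]).

    The second is a dictionary. Minimal generators form an antichain for
    divisibility, and then an increasing symbol is admissible exactly when its
    set of generators is preserved ([admissible_preserved]). A coefficient of
    the differential is a unit exactly when deleting an index does not change
    the lcm, that is, when the symbol's set is a cover of the deleted
    generator. Hence the complex is minimal iff no cover is preserved
    ([L_minimal_no_preserved_cover]), which is (i) <-> (ii).

    The other implications are about finite sets. A set [D] is broken iff
    [lcm_closure D] has an element below the minimum of [D]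
    ([broken_min_lt]). If [w] breaks [D] then [w |: D] is a cover of [w], and
    shrinking it to an E-minimal cover [w |: D'] keeps [D'] broken, as [w] stays
    below the minimum of the smaller set ([broken_E_minimal]); this yields
    (ii) -> (iii) and (iv) -> (v). Conversely the sets [D] in (iii) and (v) are
    broken, and every cover contains an E-minimal one. *)

(** * Deleting an index from a tuple *)

Lemma del_cons0 mu t (x : 'I_mu) (s : t.-tuple 'I_mu) :
  del ord0 [tuple of x :: s] = s.
Proof.
apply: eq_from_tnth => i; rewrite tnth_mktuple.
by rewrite -[RHS](tnthS x).
Qed.

Lemma del_consS mu t (j : 'I_t.+1) (x : 'I_mu) (s : t.+1.-tuple 'I_mu) :
  del (lift ord0 j) [tuple of x :: s] = [tuple of x :: del j s].
Proof.
apply: eq_from_tnth => i; rewrite tnth_mktuple.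
case: (unliftP ord0 i) => [i' ->|->].
  have -> : lift (lift ord0 j) (lift ord0 i') = lift ord0 (lift j i').
    by apply: val_inj; rewrite /= /bump !leq0n !add1n ltnS addnS.
  by rewrite !tnthS tnth_mktuple.
rewrite tnth0; have -> : lift (lift ord0 j) ord0 = ord0 by apply: val_inj.
by rewrite tnth0.
Qed.

(** The identity behind [d o d = 0], by peeling off the first index: in the
    double sum for [x :: s], the terms deleting [x] first cancel those deleting
    [x] second, and the terms that keep [x] form the double sum for [s]. *)
Lemma alternating_del_sum0 (R : pzRingType) (V : lmodType R) mu t
    (F : t.-tuple 'I_mu -> V) (s : t.+2.-tuple 'I_mu) :
  \sum_(j < t.+2) \sum_(k < t.+1)
    (-1) ^+ j *: ((-1) ^+ k *: F (del k (del j s))) = 0.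
Proof.
elim: t F s => [|t IHt] F s; case/tupleP: s => x s.
  by rewrite !big_ord_recl !big_ord0 /= del_cons0 del_consS del_cons0
             !addr0 !expr0 expr1 !scale1r scaleN1r addrN.
rewrite big_ord_recl /= del_cons0.
under [X in _ + X]eq_bigr => j _.
  rewrite big_ord_recl /= del_consS del_cons0 expr0 scale1r.
  under eq_bigr => k _.
    rewrite del_consS scalerA -exprD /bump !leq0n !add1n addSn addnS !exprS.
    rewrite !mulN1r opprK exprD -scalerA.
    over.
  rewrite /bump !leq0n !add1n exprS mulN1r scaleNr.
  over.
rewrite big_split /= (IHt (fun s' => F [tuple of x :: s'])) addr0 sumrN.
by under eq_bigr do rewrite expr0 scale1r; rewrite addrN.
Qed.

(** * Membership in ideals *)
Lemma ideal_gen_sum (R : comNzRingType) (S : R -> Prop) (T : finType)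
    (c a : T -> R) :
  (forall t, S (a t)) -> ideal_gen S (\sum_t c t * a t).
Proof.
move=> Sa; exists #|T|, (c \o enum_val), (a \o enum_val); split.
  by move=> i; apply: Sa.
by rewrite (big_enum_val (A := T)).
Qed.

Lemma ideal_smul_sum (R : comNzRingType) (M : lmodType R) (J : R -> Prop)
    (T : finType) (a : T -> R) (v : T -> M) :
  (forall t, J (a t)) -> ideal_smul J (\sum_t a t *: v t).
Proof.
move=> Ja; exists #|T|, (a \o enum_val), (v \o enum_val); split.
  by move=> i; apply: Ja.
by rewrite (big_enum_val (A := T)).
Qed.

Lemma irrelevant_monomial (K : fieldType) n (c : {mpoly K[n]}) (x : 'X_{1..n}) :
  x != 0%MM -> irrelevant_ideal (c * 'X_[x]).
Proof.
move=> nz_x; have [k xk] : exists k, x k != 0%N.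
  apply/existsP; apply: contra_neqT nz_x => /existsPn x0.
  by apply/mnmP => k; rewrite mnm0E; apply/eqP; have := x0 k; rewrite negbK.
exists 1%N, (fun=> c * 'X_[x - U_(k)]), (fun=> 'X_k).
split=> [_|]; first by exists k.
by rewrite big_ord1 -mulrA -mpolyXD submK // lep1mP.
Qed.

Lemma irrelevant_const0 (K : fieldType) n (f : {mpoly K[n]}) :
  irrelevant_ideal f -> f@_0 = 0.
Proof.
case=> N [c [a [gen_a ->]]]; rewrite raddf_sum big1 // => i _.
have [k ->] := gen_a i.
by rewrite /= rmorphM /= mcoeffX mnm1_eq0 mulr0.
Qed.
(** * The multigraded structure of the Lyubeznik complex *)
Section LyubeznikComplex.
Variables (K : fieldType) (n mu : nat) (m : 'I_mu -> 'X_{1..n}).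

Local Notation lcm s := (lcm_from m s 0).

Lemma lcm_from_le t (s : t.-tuple 'I_mu) h x :
  (lcm_from m s h <= x)%MM =
    [forall k : 'I_t, (h <= k)%N ==> (m (tnth s k) <= x)%MM].
Proof.
apply/idP/forallP => [les k|les].
  apply/implyP => hk; apply: lepm_trans les.
  by rewrite /lcm_from (bigD1 k) //= lem_mlcml.
rewrite /lcm_from; elim/big_ind: _ => [|y z ley lez|k hk].
- by apply/mnm_lepP=> i; rewrite mnmE.
- by rewrite lem_mlcm ley lez.
- exact: implyP (les k) hk.
Qed.

Lemma dvd_lcm_from t (s : t.-tuple 'I_mu) h (k : 'I_t) :
  (h <= k)%N -> (m (tnth s k) <= lcm_from m s h)%MM.
Proof.
by move=> hk; have := lepm_refl (lcm_from m s h);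
   rewrite lcm_from_le => /forallP/(_ k)/implyP; apply.
Qed.

Lemma lcm_cons t (i : 'I_mu) (s : t.-tuple 'I_mu) :
  lcm [tuple of i :: s] = mlcm (m i) (lcm s).
Proof.
rewrite /lcm_from big_mkcond big_ord_recl /= tnth0 [in RHS]big_mkcond /=.
by congr mlcm; apply: eq_bigr => k _; rewrite tnthS.
Qed.

Lemma lcm_del t j (s : t.+1.-tuple 'I_mu) : (lcm (del j s) <= lcm s)%MM.
Proof.
by rewrite lcm_from_le; apply/forallP => k; rewrite tnth_mktuple dvd_lcm_from.
Qed.

(** Fixes the ring of scalars: in the definition of [L_diff] it is inferred as
    the regular module [{mpoly K[n]}^o], on which the rewriting lemmas for
    scaling do not fire. *)
Lemma L_diffE t (f : L_module K m t.+1) :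
  L_diff f =
    \sum_s (f s : {mpoly K[n]}) *: (L_diff_symbol K s : L_module K m t).
Proof. by []. Qed.

Lemma L_diff_is_linear t : linear (@L_diff K n mu m t).
Proof.
move=> a f g; rewrite /L_diff scaler_sumr -big_split /=.
by apply: eq_bigr => s _; rewrite !ffunE scalerDl scalerA.
Qed.
HB.instance Definition _ t :=
  GRing.isLinear.Build {mpoly K[n]} (L_module K m t.+1) (L_module K m t)
    _ (@L_diff K n mu m t) (@L_diff_is_linear t).

Lemma L_diffZ t a (f : L_module K m t.+1) : L_diff (a *: f) = a *: L_diff f.
Proof. exact: linearZ. Qed.

Lemma L_diffD t (f g : L_module K m t.+1) :
  L_diff (f + g) = L_diff f + L_diff g.
Proof. exact: linearD. Qed.

Lemma L_diff0 t : L_diff (0 : L_module K m t.+1) = 0.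
Proof. exact: linear0. Qed.

Lemma L_diff_sum t I r (F : I -> L_module K m t.+1) :
  L_diff (\sum_(i <- r) F i) = \sum_(i <- r) L_diff (F i).
Proof. exact: raddf_sum. Qed.

Lemma L_diff_basis t (s : L_symbol m t.+1) :
  L_diff (L_basis K s) = L_diff_symbol K s.
Proof.
rewrite /L_diff (bigD1 s) //= big1 ?addr0 ?ffunE ?eqxx ?scale1r // => s' neq.
by rewrite ffunE (negPf neq) scale0r.
Qed.

(** Defined for all tuples and zero on inadmissible ones, so that [L_diff] and
    [cone] act on plain tuples by deletion and insertion, without admissibility
    proofs in the terms. *)
Definition homog_elt t (x : 'X_{1..n}) (s : t.-tuple 'I_mu) : L_module K m t :=
  [ffun s' => if val s' == s then 'X_[x - lcm s] else 0].

Lemma homog_eltE t x (s : L_symbol m t) :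
  homog_elt x (val s) = 'X_[x - lcm (val s)] *: L_basis K s.
Proof.
apply/ffunP => s'; rewrite !ffunE (inj_eq val_inj) -[LHS]/(if _ then _ else _).
by case: eqP => _; rewrite /GRing.scale /= ?mulr1 ?mulr0.
Qed.

Lemma homog_elt_inadmissible t x (s : t.-tuple 'I_mu) :
  ~~ L_admissible m s -> homog_elt x s = 0.
Proof.
move=> nadm; apply/ffunP => s'; rewrite !ffunE.
by case: eqP => // def_s; rewrite -def_s (valP s') in nadm.
Qed.

(** The coefficients [lcm s / lcm (del j s)] are exactly what is needed to
    preserve the multidegree [x]. *)
Lemma L_diff_homog t x (s : t.+1.-tuple 'I_mu) :
    L_admissible m s -> (lcm s <= x)%MM ->
  L_diff (homog_elt x s) = \sum_(j < t.+1) (-1) ^+ j *: homog_elt x (del j s).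
Proof.
move=> adm le_sx; pose s' : L_symbol m t.+1 := exist _ s adm.
rewrite -[s]/(val s') homog_eltE L_diffZ L_diff_basis scaler_sumr.
apply: eq_bigr => j _.
have coef_x : 'X_[x - lcm s] * 'X_[lcm s - lcm (del j s)] =
    'X_[x - lcm (del j s)] :> {mpoly K[n]}.
  by rewrite -mpolyXD addmBA ?lcm_del // submK.
by rewrite -[del j s]/(val (del_symbol j s')) homog_eltE !scalerA mulrCA coef_x.
Qed.

Lemma L_basis_homog t (s : L_symbol m t.+1) :
  L_basis K s = homog_elt (lcm (val s)) (val s).
Proof.
rewrite homog_eltE; have -> : (lcm (val s) - lcm (val s) = 0)%MM.
  by apply/mnmP => i; rewrite mnmBE mnm0E subnn.
by rewrite mpolyX0 scale1r.
Qed.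

Lemma L_diff_diff t (f : L_module K m t.+2) : L_diff (L_diff f) = 0.
Proof.
rewrite (L_diffE f) L_diff_sum big1 // => s _.
rewrite /= L_diffZ -L_diff_basis L_basis_homog /=.
rewrite L_diff_homog ?(valP s) ?lepm_refl // L_diff_sum /=.
under eq_bigr => j _.
  rewrite L_diffZ L_diff_homog ?lcm_del ?L_admissible_del ?(valP s) //.
  rewrite scaler_sumr.
  over.
by rewrite alternating_del_sum0 scaler0.
Qed.

Lemma L_module_sumE t I r (F : I -> L_module K m t) s :
  (\sum_(i <- r) F i) s = \sum_(i <- r) F i s.
Proof.
exact: (@big_morph _ _ (fun f : L_module K m t => f s) 0 +%R 0 +%R
  (fun f g => ffunE _ _) (ffunE _ _)).
Qed.

Lemma L_module_scaleE t (c : {mpoly K[n]}) (f : L_module K m t) s :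
  (c *: f) s = c * f s :> {mpoly K[n]}.
Proof. exact: ffunE. Qed.

Lemma L_diff_symbol_coord t (s : L_symbol m t.+1) s' :
  L_diff_symbol K s s' = \sum_(j < t.+1)
    (-1) ^+ j * 'X_[lcm (val s) - lcm (val (del_symbol j s))] *
      (s' == del_symbol j s)%:R :> {mpoly K[n]}.
Proof.
rewrite /L_diff_symbol L_module_sumE; apply: eq_bigr => j _.
by rewrite !ffunE.
Qed.

(** The homogeneous elements span the module over the coefficient field, so it
    is enough to check additive and [K]-linear identities on them. *)
Lemma homog_ind t (P : L_module K m t -> Prop) :
    P 0 -> (forall f g, P f -> P g -> P (f + g)) ->
    (forall (c : K) f, P f -> P (c%:MP *: f)) ->
    (forall x s, L_admissible m s -> (lcm s <= x)%MM -> P (homog_elt x s)) ->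
  forall f, P f.
Proof.
move=> P0 PD PZ Phomog f.
have -> : f = \sum_s \sum_(a <- msupp (f s))
    ((f s)@_a)%:MP *: homog_elt (a + lcm (val s)) (val s).
  apply/ffunP => s; rewrite L_module_sumE (bigD1 s) //.
  rewrite [X in _ = _ + X]big1 => [|s' neq].
    rewrite addr0 L_module_sumE [LHS]mpolyE; apply: eq_bigr => a _.
    by rewrite !ffunE eqxx addmK -mul_mpolyC.
  rewrite L_module_sumE big1 // => a _.
  rewrite !ffunE (inj_eq val_inj) eq_sym (negPf neq); exact: scaler0.
elim/big_ind: _ => // s _; elim/big_ind: _ => // a _; apply: PZ.
by apply: Phomog; rewrite ?(valP s) ?lem_addl.
Qed.

(** * The contracting homotopy *)

(** The [K]-linear map sending the monomial [a] to [phi a]; it is not linear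
    over polynomials, because the apex of the cone depends on the
    multidegree. *)
Definition coef_ext (V : lmodType {mpoly K[n]}) (phi : 'X_{1..n} -> V)
  (p : {mpoly K[n]}) : V := \sum_(a <- msupp p) (p@_a)%:MP *: phi a.

Section CoefExt.
Variables (V : lmodType {mpoly K[n]}) (phi : 'X_{1..n} -> V).

(** Replaces the support, which depends on the polynomial, by an index set that
    several polynomials can share. *)
Lemma coef_ext_bound k p : (msize p <= k)%N ->
  coef_ext phi p = \sum_(a : 'X_{1..n < k}) (p@_a)%:MP *: phi a.
Proof.
move=> le_pk; pose bounded : subFinType _ := 'X_{1..n < k}.
rewrite /coef_ext (big_mksub bounded) ?msupp_uniq //=; first last.
  by move=> a /msize_mdeg_lt /leq_trans; apply.
rewrite big_rmcond //= => a /memN_msupp_eq0 ->.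
by rewrite mpolyC0 scale0r.
Qed.

Lemma coef_extD p q : coef_ext phi (p + q) = coef_ext phi p + coef_ext phi q.
Proof.
pose k := maxn (msize (p + q)) (maxn (msize p) (msize q)).
rewrite !(@coef_ext_bound k) ?leq_max ?leqnn ?orbT // -big_split /=.
by apply: eq_bigr => a _; rewrite mcoeffD mpolyCD scalerDl.
Qed.

Lemma coef_extZ c p : coef_ext phi (c%:MP * p) = c%:MP *: coef_ext phi p.
Proof.
pose k := maxn (msize (c%:MP * p)) (msize p).
rewrite !(@coef_ext_bound k) ?leq_max ?leqnn ?orbT // scaler_sumr.
by apply: eq_bigr => a _; rewrite mcoeffCM mpolyCM scalerA.
Qed.

Lemma coef_ext0 : coef_ext phi 0 = 0.
Proof. by rewrite /coef_ext msupp0 big_nil. Qed.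

Lemma coef_extX a : coef_ext phi 'X_[a] = phi a.
Proof. by rewrite /coef_ext msuppX big_seq1 mcoeffX eqxx scale1r. Qed.
End CoefExt.

Definition least_divisor (x : 'X_{1..n}) : option 'I_mu :=
  [pick q : 'I_mu | (m q <= x)%MM &
    [forall p : 'I_mu, (p < q)%N ==> ~~ (m p <= x)%MM]].

(** When [q] already occurs in [s], the tuple [q :: s] is inadmissible and
    [homog_elt] is zero on it, so this case needs no test. *)
Definition cone_elt t x (s : t.-tuple 'I_mu) : L_module K m t.+1 :=
  if least_divisor x is Some q then homog_elt x [tuple of q :: s] else 0.

Definition cone t (f : L_module K m t) : L_module K m t.+1 :=
  \sum_s coef_ext (fun a => cone_elt (a + lcm (val s)) (val s)) (f s).

Lemma coneD t (f g : L_module K m t) : cone (f + g) = cone f + cone g.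
Proof.
rewrite /cone -big_split; apply: eq_bigr => s _.
by rewrite ffunE coef_extD.
Qed.

Lemma coneZ t (c : K) (f : L_module K m t) :
  cone (c%:MP *: f) = c%:MP *: cone f.
Proof.
rewrite /cone scaler_sumr; apply: eq_bigr => s _.
by rewrite ffunE coef_extZ.
Qed.

Lemma cone0 t : cone (0 : L_module K m t) = 0.
Proof. by rewrite /cone big1 // => s _; rewrite ffunE coef_ext0. Qed.

Lemma cone_sign_sum t N (f : 'I_N -> L_module K m t) :
  cone (\sum_(j < N) (-1) ^+ j *: f j) = \sum_(j < N) (-1) ^+ j *: cone (f j).
Proof.
rewrite (big_morph _ (@coneD t) (cone0 t)); apply: eq_bigr => j _.
have -> : (-1) ^+ j = ((-1) ^+ j)%:MP :> {mpoly K[n]}.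
  by rewrite rmorphXn /= mpolyCN mpolyC1.
exact: coneZ.
Qed.

Lemma cone_homog t x (s : t.-tuple 'I_mu) :
  L_admissible m s -> (lcm s <= x)%MM -> cone (homog_elt x s) = cone_elt x s.
Proof.
move=> adm le_sx; pose s' : L_symbol m t := exist _ s adm.
rewrite /cone (bigD1 s') //= big1 ?addr0.
  by rewrite ffunE eqxx coef_extX submK.
move=> s2 neq; rewrite ffunE.
have -> : (val s2 == s) = false.
  by apply: contraNF neq => /eqP def_s; apply/eqP/val_inj.
exact: coef_ext0.
Qed.

Lemma least_divisorP x : (exists i, m i <= x)%MM ->
  exists q, [/\ least_divisor x = Some q, (m q <= x)%MM &
                forall p, (m p <= x)%MM -> (q <= p)%N].
Proof.
move=> [i le_ix]; rewrite /least_divisor; case: pickP => [q|none].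
  case/andP=> le_qx /forallP minq; exists q; split=> // p le_px.
  by rewrite leqNgt; apply: contraL le_px; apply: implyP.
have [q le_qx minq] := @arg_minnP _ i (fun i => m i <= x)%MM val le_ix.
have /negP[] := negbT (none q); rewrite le_qx; apply/forallP => p.
by apply/implyP; rewrite ltnNge; apply: contra; apply: minq.
Qed.

Hypothesis m_antichain : forall i j, (m i <= m j)%MM -> i = j.

(** At the last index the lcm is a single generator, which no other member of an
    antichain divides, so the divisibility condition holds there as well. *)
Lemma L_admissibleP t (s : t.-tuple 'I_mu) :
  L_admissible m s <->
    (forall i j : 'I_t, (i < j)%N -> (tnth s i < tnth s j)%N) /\
    (forall (h : 'I_t) q, (m q <= lcm_from m s h)%MM -> (tnth s h <= q)%N).
Proof.
split=> [/andP[/forallP incr /forallP adm]|[incr adm]].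
  split=> [i j|h q le_q]; first exact: implyP (forallP (incr i) j).
  rewrite leqNgt; apply/negP => lt_q.
  have := implyP (forallP (adm h) q); rewrite lt_q andbT le_q => lt_ht.
  have last_h : (t <= h.+1)%N by rewrite leqNgt; apply/negP => /lt_ht.
  (* [h] is the last position: the lcm is the single generator [m (tnth s h)] *)
  suff def_q : q = tnth s h by rewrite def_q ltnn in lt_q.
  apply: m_antichain; apply: lepm_trans le_q _; rewrite lcm_from_le.
  apply/forallP => k; apply/implyP => le_hk.
  suff -> : k = h by apply: lepm_refl.
  apply/val_inj/eqP; rewrite eqn_leq le_hk andbT -ltnS.
  exact: leq_trans (ltn_ord k) last_h.
apply/andP; split; apply/forallP => h; apply/forallP => q; apply/implyP.
  exact: incr.
by case/andP => _; rewrite ltnNge; apply: contra; apply: adm.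
Qed.

(** At the new first position only indices below [q] are excluded, and none of
    them divides [x], let alone the lcm; the later positions are those
    of [s]. *)
Lemma L_admissible_cons t x q (s : t.-tuple 'I_mu) :
    L_admissible m s -> (lcm s <= x)%MM -> (m q <= x)%MM ->
    (forall p, (m p <= x)%MM -> (q <= p)%N) ->
    (forall i, tnth s i != q) ->
  L_admissible m [tuple of q :: s].
Proof.
move=> /L_admissibleP[incr adm] le_sx le_qx minq neq.
have le_k (k : 'I_t) : (m (tnth s k) <= x)%MM.
  by apply: lepm_trans le_sx; apply: dvd_lcm_from.
apply/L_admissibleP; split=> [i j|h p].
  case: (unliftP ord0 j) => [j' ->|-> //].
  case: (unliftP ord0 i) => [i' ->|-> _]; rewrite ?tnthS ?tnth0.
    by rewrite /= /bump !leq0n !add1n ltnS; apply: incr.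
  by rewrite ltn_neqAle eq_sym (inj_eq val_inj) neq minq.
case: (unliftP ord0 h) => [h' ->|->]; rewrite ?tnthS ?tnth0 => le_p.
  apply: adm; apply: lepm_trans le_p _; rewrite lcm_from_le.
  apply/forallP => k; apply/implyP.
  case: (unliftP ord0 k) => [k' ->|->].
    by rewrite tnthS /= /bump !leq0n !add1n ltnS; apply: dvd_lcm_from.
  by rewrite /= /bump leq0n.
apply: minq; apply: lepm_trans le_p _.
by rewrite lcm_cons lem_mlcm le_qx.
Qed.

Lemma L_inadmissible_dup t (s : t.-tuple 'I_mu) q :
  q \in s -> ~~ L_admissible m [tuple of q :: s].
Proof.
case/tnthP => i def_q.
apply/negP => /L_admissibleP[/(_ ord0 (lift ord0 i) isT)].
by rewrite tnth0 tnthS def_q ltnn.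
Qed.

(** On a homogeneous element [homog_elt x s], either [q] is the first index of
    [s], and then only the term of the differential that deletes [q] survives
    under [cone]; or it is not, and the terms of the differential of [q :: s]
    that keep [q] cancel against the cone of the differential of [s]. The
    degree is positive because the empty symbol has no index that would provide
    a generator dividing [x]. *)
Lemma cone_homotopy t (f : L_module K m t.+1) :
  L_diff (cone f) + cone (L_diff f) = f.
Proof.
elim/homog_ind: f => [|f g IHf IHg|c f IHf|x s adm le_sx].
- by rewrite cone0 !L_diff0 cone0 addr0.
- by rewrite (coneD f g) (L_diffD f g) (L_diffD (cone f) (cone g))
     (coneD (L_diff f) (L_diff g)) -[in RHS]IHf -[in RHS]IHg; exact: addrACA.
- by rewrite (coneZ c f) (L_diffZ _ f) (L_diffZ _ (cone f))
     (coneZ c (L_diff f)) -scalerDr IHf.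
have le_k k : (m (tnth s k) <= x)%MM.
  by apply: lepm_trans le_sx; apply: dvd_lcm_from.
have [q [def_q le_qx minq]] :=
  least_divisorP (ex_intro (fun i => (m i <= x)%MM) _ (le_k ord0)).
rewrite cone_homog // L_diff_homog // cone_sign_sum.
have cone_del j : cone (homog_elt x (del j s)) =
    homog_elt x [tuple of q :: del j s].
  rewrite cone_homog ?L_admissible_del /cone_elt ?def_q //.
  by apply: lepm_trans le_sx; apply: lcm_del.
under eq_bigr do rewrite cone_del.
rewrite /cone_elt def_q; case/tupleP: s => i s in adm le_sx le_k cone_del *.
(* whether the least divisor [q] of [x] is the first index of the symbol *)
have [eq_iq|neq_iq] := eqVneq i q.
  rewrite homog_elt_inadmissible ?L_diff0 ?add0r; last first.
    by rewrite L_inadmissible_dup ?eq_iq ?in_cons ?eqxx.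
  rewrite big_ord_recl del_cons0 expr0 scale1r eq_iq big1 ?addr0 // => j _.
  move: j; case: t s {adm le_sx le_k cone_del} => [|t] s j; first by case: j.
  rewrite homog_elt_inadmissible ?scaler0 // del_consS.
  by rewrite L_inadmissible_dup ?eq_iq ?in_cons ?eqxx.
have adm_q : L_admissible m [tuple of q :: [tuple of i :: s]].
  apply: (L_admissible_cons adm le_sx le_qx minq) => k.
  case: (unliftP ord0 k) => [k' ->|->]; last by rewrite tnth0.
  apply/eqP => def_k; have /L_admissibleP[incr _] := adm.
  have := incr ord0 (lift ord0 k') isT; rewrite def_k tnth0 ltnNge minq //.
  by have := le_k ord0; rewrite tnth0.
rewrite L_diff_homog //; last by rewrite lcm_cons lem_mlcm le_qx.
rewrite big_ord_recl del_cons0 expr0 scale1r -addrA -[RHS]addr0.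
congr (_ + _); rewrite -big_split big1 //= => j _.
by rewrite del_consS /bump leq0n add1n exprS mulN1r scaleNr addNr.
Qed.

(** * Exactness and minimality *)
Lemma lcm_singleton i : lcm [tuple i] = m i.
Proof. by rewrite /lcm_from big_ord_recl big_ord0 mlcm0 tnth0. Qed.

Lemma L_singleton_admissible i : L_admissible m [tuple i].
Proof.
apply/L_admissibleP; split=> [j k|h q]; first by rewrite !ord1.
have -> : lcm_from m [tuple i] h = m i.
  by rewrite ord1 /lcm_from big_ord_recl big_ord0 mlcm0 tnth0.
by move/m_antichain ->; rewrite ord1 tnth0.
Qed.

Lemma L_diff_singleton i :
  L_diff (homog_elt (m i) [tuple i]) (nil_symbol m) = 'X_[m i].
Proof.
rewrite L_diff_homog ?L_singleton_admissible ?lcm_singleton ?lepm_refl //.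
rewrite big_ord_recl big_ord0 addr0 del_cons0 expr0 scale1r ffunE eqxx.
by rewrite /lcm_from big_ord0 subm0.
Qed.

Lemma L_symbol0 (s : L_symbol m 0) : s = nil_symbol m.
Proof. by apply: val_inj; rewrite /= [LHS]tuple0. Qed.

Lemma Lyubeznik_resolves (I : {mpoly K[n]} -> Prop) :
    (forall f, I f <-> mon_ideal_gen (fun x => exists i, x = m i) f) ->
  L_resolves m I.
Proof.
move=> genI; split=> [f|t f]; split.
- case=> g <-; apply/genI.
  have -> : L_diff g (nil_symbol m) =
      \sum_s (g s : {mpoly K[n]}) * 'X_[m (tnth (val s) ord0)].
    rewrite L_diffE L_module_sumE; apply: eq_bigr => s _.
    have def_s : val s = [tuple tnth (val s) ord0].
      by apply: eq_from_tnth => k; rewrite ord1 tnth0.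
    by rewrite L_module_scaleE -L_diff_basis L_basis_homog def_s lcm_singleton
               L_diff_singleton tnth0.
  apply: ideal_gen_sum => s.
  by exists (m (tnth (val s) ord0)); first exists (tnth (val s) ord0).
- move=> /genI[N [c [a [a_gen def_f]]]].
  have ex_k i : exists k, a i = 'X_[m k].
    by have [x [k ->] ->] := a_gen i; exists k.
  have [k def_a] := fin_all_exists ex_k.
  exists (\sum_i c i *: homog_elt (m (k i)) [tuple k i]).
  apply/ffunP => s; rewrite (L_symbol0 s) def_f L_diff_sum L_module_sumE.
  by apply: eq_bigr => i _; rewrite L_diffZ ffunE L_diff_singleton def_a.
- by case=> g <-; apply: L_diff_diff.
by move=> cyc; exists (cone f); rewrite -[RHS]cone_homotopy cyc cone0 addr0.
Qed.

(** Distinct deletions give distinct basis elements, so no cancellation hides a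
    unit coefficient of the differential. *)
Lemma del_inj t (s : t.+1.-tuple 'I_mu) i j :
  injective (tnth s) -> del i s = del j s -> i = j.
Proof.
move=> inj_s eq_del; case: (unliftP i j) => [j' def_j|-> //].
have : tnth (del i s) j' \in del j s by rewrite eq_del mem_tnth.
case/tnthP => k; rewrite !tnth_mktuple -def_j => /inj_s eq_jk.
by have := neq_lift j k; rewrite -eq_jk eqxx.
Qed.

Lemma increasing_inj t (s : t.-tuple 'I_mu) :
    (forall i j : 'I_t, (i < j)%N -> (tnth s i < tnth s j)%N) ->
  injective (tnth s).
Proof.
move=> incr i j eq_ij; apply: val_inj; apply/eqP.
by case: ltngtP => // /incr; rewrite eq_ij ltnn.
Qed.

(** A coefficient of the differential is, up to sign, a monomial: it lies in
    the irrelevant ideal unless it is 1, that is, unless deleting the index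
    leaves the lcm unchanged. *)
Lemma L_minimalP :
  L_minimal K m <->
  forall t (s : t.+1.-tuple 'I_mu) j, L_admissible m s ->
    ~~ (m (tnth s j) <= lcm (del j s))%MM.
Proof.
split=> [minL t s j adm|irred t f].
  apply/negP => le_j; pose s' : L_symbol m t.+1 := exist _ s adm.
  have /L_admissibleP[/increasing_inj inj_s _] := adm.
  have [N [a [v [a_irr def_w]]]] := minL t (L_basis K s').
  have eq_lcm : (lcm s - lcm (del j s) = 0)%MM.
    apply/mnmP => i; rewrite mnmBE mnm0E; apply/eqP; rewrite subn_eq0.
    apply: (mnm_lepP _ i); rewrite lcm_from_le; apply/forallP => k.
    case: (unliftP j k) => [k' ->|->]; rewrite ?le_j ?implybT //=.
    by have := dvd_lcm_from (del j s) (leq0n k'); rewrite tnth_mktuple.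
  (* minimality kills the constant term, but deleting [j] contributes +-1 *)
  have : (L_diff (L_basis K s') (del_symbol j s'))@_0 = 0.
    rewrite def_w L_module_sumE raddf_sum big1 // => i _.
    rewrite /= L_module_scaleE rmorphM /=.
    by rewrite (irrelevant_const0 (a_irr i)) mul0r.
  rewrite L_diff_basis L_diff_symbol_coord (bigD1 j) //= eqxx eq_lcm mpolyX0.
  rewrite big1 => [|i neq_ij]; last first.
    case: eqP => [/(congr1 val)/= eq_del|_]; last by rewrite mulr0.
    by rewrite (del_inj inj_s eq_del) eqxx in neq_ij.
  rewrite addr0 !mulr1 => /eqP.
  by rewrite rmorphXn rmorphN rmorph1 signr_eq0.
rewrite L_diffE.
pose a (sj : L_symbol m t.+1 * 'I_t.+1) : {mpoly K[n]} :=
  f sj.1 * (-1) ^+ sj.2 *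
    'X_[lcm (val sj.1) - lcm (val (del_symbol sj.2 sj.1))].
pose v (sj : L_symbol m t.+1 * 'I_t.+1) : L_module K m t :=
  L_basis K (del_symbol sj.2 sj.1).
have -> : \sum_s (f s : {mpoly K[n]}) *: (L_diff_symbol K s : L_module K m t) =
    \sum_sj a sj *: v sj.
  rewrite -(pair_bigA _ (fun s j => a (s, j) *: v (s, j))) /=.
  apply: eq_bigr => s _; rewrite scaler_sumr; apply: eq_bigr => j _.
  by rewrite /a /= -mulrA; apply: scalerA.
apply: ideal_smul_sum => -[s j]; apply: irrelevant_monomial.
apply: contra (irred t _ j (valP s)) => /eqP lcm0.
have := dvd_lcm_from (val s) (leq0n j) => /lepm_trans; apply.
apply/mnm_lepP => i; rewrite -subn_eq0 -mnmBE.
by rewrite [(_ - _)%MM]lcm0 mnm0E.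
Qed.

End LyubeznikComplex.

(** * Minimal generators and covers *)
Section MinimalGenerators.
Variables (n : nat) (G : {fset 'X_{1..n}}).
Implicit Types (u v : G) (A C D : {set G}).

Lemma lepm_anti (x y : 'X_{1..n}) : (x <= y)%MM -> (y <= x)%MM -> x = y.
Proof.
move=> /mnm_lepP le_xy /mnm_lepP le_yx.
by apply/mnmP => i; apply/eqP; rewrite eqn_leq le_xy le_yx.
Qed.

(** A generator that is a multiple of another one could be removed. *)
Lemma minimal_generators_antichain (K : fieldType) (I : {mpoly K[n]} -> Prop) :
  minimal_mon_generators I G -> forall u v, (val u <= val v)%MM -> u = v.
Proof.
case=> genG minG u v le_uv; apply/eqP/negPn/negP => neq_uv.
apply: (minG (G `\ val v)%fset); first exact/fproperD1/fsvalP.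
move=> f; rewrite (genG f); split=> [[N [c [a [a_gen ->]]]]|]; last first.
  case=> N [c [a [a_gen ->]]]; exists N, c, a; split=> // i.
  have [x /fsetD1P[_ xG] ->] := a_gen i; by exists x.
have a_mult i : exists ba : {mpoly K[n]} * 'X_{1..n},
    ba.2 \in (G `\ val v)%fset /\ a i = ba.1 * 'X_[ba.2].
  have [x xG ->] := a_gen i.
  have [->|neq_xv] := eqVneq x (val v).
    exists ('X_[val v - val u], val u); split.
      by rewrite in_fsetD1 (inj_eq val_inj) neq_uv; exact: fsvalP.
    by rewrite -mpolyXD submK.
  by exists (1, x); rewrite in_fsetD1 neq_xv mul1r.
have [ba ba_spec] := fin_all_exists a_mult.
exists N, (fun i => c i * (ba i).1), (fun i => 'X_[(ba i).2]).
split=> [i|]; first by have [baG _] := ba_spec i; exists (ba i).2.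
by apply: eq_bigr => i _; have [_ ->] := ba_spec i; rewrite mulrA.
Qed.

Lemma lcm_set_le A (x : 'X_{1..n}) :
  (lcm_set A <= x)%MM <-> forall u, u \in A -> (val u <= x)%MM.
Proof.
rewrite /lcm_set; split=> [le_x u uA|le_x].
  by apply: lepm_trans le_x; rewrite (bigD1 u) //= lem_mlcml.
elim/big_ind: _ => [|y z ley lez|u uA]; last exact: le_x.
- by apply/mnm_lepP=> i; rewrite mnmE.
- by rewrite lem_mlcm ley lez.
Qed.

Lemma dvd_lcm_set A u : u \in A -> (val u <= lcm_set A)%MM.
Proof. by have /lcm_set_le := lepm_refl (lcm_set A); apply. Qed.

Lemma is_cover_setU1 D v :
  v \notin D -> (val v <= lcm_set D)%MM -> is_cover v (v |: D).
Proof. by move=> vD le_v; split; rewrite ?setU11 // setU1K. Qed.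

Lemma E_minimal_subcover u C : is_cover u C ->
  exists2 C' : {set G}, C' \subset C & E_minimal_cover u C'.
Proof.
move=> [uC le_u].
pose P := [pred A : {set G} | (u \in A) && (val u <= lcm_set (A :\ u))%MM].
have [|C' /minsetP[/andP[uC' le_u'] minC'] sC'C] := @minset_exists _ P C.
  by rewrite /= uC.
exists C' => //; split=> // A /andP[sAC' nsC'A] [uA le_uA].
by rewrite (minC' A) ?subxx // /P /= uA in nsC'A.
Qed.

End MinimalGenerators.

(** * Broken sets *)
Section Broken.
Variables (n : nat) (G : {fset 'X_{1..n}}) (lt : rel G).
Hypothesis hlt : strict_total_order lt.
Implicit Types (u v w : G) (A C D : {set G}).

(** An element with the fewest elements below it. *)
Lemma min_exists A : A != set0 -> exists u, is_min lt A u.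
Proof.
have [irr tr tot] := hlt; case/set0Pn => u0 u0A.
pose below u := #|[set w | lt w u]|.
have [u uA min_u] := @arg_minnP _ u0 (mem A) below u0A.
exists u; split=> // v vA neq_vu.
have /orP[lt_vu|//] := tot v u neq_vu.
have /negP[] : ~~ (below u <= below v)%N.
  rewrite -ltnNge; apply/proper_card/properP; split.
    by apply/subsetP => w; rewrite !inE => /tr; apply.
  by exists v; rewrite !inE ?irr.
exact: min_u.
Qed.

Lemma min_le A u v : is_min lt A u -> v \in A -> (u == v) || lt u v.
Proof.
by case=> _ minu vA; case: eqVneq => //= neq; apply: minu; rewrite 1?eq_sym.
Qed.

Lemma below_min_notin D w v : is_min lt D v -> lt w v -> w \notin D.
Proof.
have [irr tr _] := hlt => minv lt_wv; apply/negP => /(min_le minv).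
by case/orP => [/eqP def_v|/(tr _ _ _ lt_wv)]; rewrite ?def_v irr // in lt_wv *.
Qed.

Lemma broken_min_lt D : broken lt D <-> min_lt lt (lcm_closure D :\: D) D.
Proof.
have [_ tr _] := hlt; split=> [[w [v [le_w minv lt_wv]]]|]; last first.
  by case=> w [v [[]]]; rewrite !inE => /andP[_ le_w] _ minv lt_wv; exists w, v.
have wcl : w \in lcm_closure D :\: D by rewrite !inE (below_min_notin minv).
have [|x minx] := @min_exists (lcm_closure D :\: D).
  by apply/set0Pn; exists w.
exists x, v; split=> //.
by have /orP[/eqP->|/tr] := min_le minx wcl; last apply.
Qed.

Lemma not_preserved C : ~ preserved lt C ->
  exists2 D : {set G}, D \subset C & broken lt D.
Proof.
move=> npC; apply: NNPP => no_broken; apply: npC => D sDC brD.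
by apply: no_broken; exists D.
Qed.

Hypothesis antichain : forall u v, (val u <= val v)%MM -> u = v.

(** Shrink [w |: D], where [w] breaks [D], to an E-minimal cover of [w]: the
    minimum can only go up, so [w] still breaks what is left of [D]. *)
Lemma broken_E_minimal D : broken lt D -> exists (D' : {set G}) v,
  [/\ D' \subset D, v \notin D', E_minimal_cover v (v |: D') & broken lt D'].
Proof.
have [irr tr _] := hlt; case=> w [v [le_w minv lt_wv]].
have wD := below_min_notin minv lt_wv.
have [C sCD [[wC le_wC] minC]] := E_minimal_subcover (is_cover_setU1 wD le_w).
have sD'D : C :\ w \subset D by rewrite subDset.
exists (C :\ w), w; rewrite setD1K // !inE eqxx; split=> //.
have [|x minx] := @min_exists (C :\ w).
  (* otherwise [w] is the monomial 1, which divides the element [v] of [D] *)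
  apply: contraTneq lt_wv => C0; suff -> : w = v by rewrite irr.
  apply: antichain; apply: lepm_trans le_wC _.
  by rewrite C0; apply/lcm_set_le => u; rewrite inE.
exists w, x; split=> //.
have /orP[/eqP<- //|] := min_le minv (subsetP sD'D _ (proj1 minx)).
exact: tr lt_wv.
Qed.

End Broken.

(** * Admissible symbols and preserved sets *)
Section OrderedGenerators.
Variables (n : nat) (G : {fset 'X_{1..n}}) (lt : rel G).
Hypothesis hlt : strict_total_order lt.
Hypothesis antichain : forall u v : G, (val u <= val v)%MM -> u = v.
Implicit Types (u v w : G) (A C D : {set G}).

Local Notation mu := #|{: G}|.
Local Notation m := (ord_gen lt).

Definition ranked_gen (i : 'I_mu) : G :=
  tnth (sort_tuple (fun u v => (u == v) || lt u v) (enum_tuple {: G})) i.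

Local Notation g := ranked_gen.

Lemma ord_genE i : m i = val (g i).
Proof. by []. Qed.

Lemma ranked_gen_surj u : exists i, g i = u.
Proof.
have : u \in sort_tuple (fun u v => (u == v) || lt u v) (enum_tuple {: G}).
  by rewrite mem_sort mem_enum.
by case/tnthP => i ->; exists i.
Qed.

Lemma ranked_gen_inj : injective g.
Proof.
apply/tuple_uniqP; rewrite sort_uniq; exact: enum_uniq.
Qed.

Lemma lt_ranked_gen i j : lt (g i) (g j) = (i < j)%N.
Proof.
have [irr tr tot] := hlt; pose le u v := (u == v) || lt u v.
have le_trans : transitive le.
  move=> v u w /orP[/eqP-> //|lt_uv] /orP[/eqP<-|lt_vw]; rewrite /le.
    by rewrite lt_uv orbT.
  by rewrite (tr _ _ _ lt_uv lt_vw) orbT.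
have le_total : total le.
  by move=> u v; rewrite /le; case: eqVneq => //= /tot/orP[]->; rewrite ?orbT.
have lt_homo (k l : 'I_mu) : (k < l)%N -> lt (g k) (g l).
  move=> lt_kl; have : le (g k) (g l).
    have x0 : G := g k; rewrite /ranked_gen !(tnth_nth x0).
    apply: sorted_ltn_nth => //.
    - exact: sort_sorted.
    - by rewrite inE size_tuple ltn_ord.
    by rewrite inE size_tuple ltn_ord.
  by case/orP => // /eqP/ranked_gen_inj eq_kl; rewrite eq_kl ltnn in lt_kl.
apply/idP/idP => [lt_ij|]; last exact: lt_homo.
case: ltngtP (erefl (val i)) => // [lt_ji|eq_ij] _.
  by have := tr _ _ _ lt_ij (lt_homo _ _ lt_ji); rewrite irr.
by rewrite (val_inj eq_ij) irr in lt_ij.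
Qed.

Definition symbol_set t (s : t.-tuple 'I_mu) : {set G} := [set g i | i in s].

Lemma symbol_setP t (s : t.-tuple 'I_mu) u :
  reflect (exists k, u = g (tnth s k)) (u \in symbol_set s).
Proof.
apply: (iffP imsetP) => [[i /tnthP[k ->] ->]|[k ->]]; first by exists k.
by exists (tnth s k); rewrite ?mem_tnth.
Qed.

Lemma lcm_symbol_set t (s : t.-tuple 'I_mu) :
  lcm_set (symbol_set s) = lcm_from m s 0.
Proof.
apply: lepm_anti.
  by apply/lcm_set_le => _ /symbol_setP[k ->]; rewrite -ord_genE dvd_lcm_from.
rewrite lcm_from_le; apply/forallP => k /=.
by rewrite ord_genE dvd_lcm_set //; apply/symbol_setP; exists k.
Qed.

Lemma symbol_set_del t (s : t.+1.-tuple 'I_mu) j :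
  injective (tnth s) -> symbol_set (del j s) = symbol_set s :\ g (tnth s j).
Proof.
move=> inj_s; apply/setP => u; rewrite in_setD1.
apply/symbol_setP/andP => [[k ->]|[neq_u /symbol_setP[k def_u]]].
  rewrite tnth_mktuple (inj_eq ranked_gen_inj) (inj_eq inj_s) lift_eqF.
  by split=> //; apply/symbol_setP; exists (lift j k).
case: (unliftP j k) def_u neq_u => [k' ->|->] -> //; last by rewrite eqxx.
by exists k'; rewrite tnth_mktuple.
Qed.

Lemma symbol_set_cover t (s : t.+1.-tuple 'I_mu) j :
    injective (tnth s) ->
  is_cover (g (tnth s j)) (symbol_set s) <->
    (m (tnth s j) <= lcm_from m (del j s) 0)%MM.
Proof.
move=> inj_s; rewrite /is_cover -symbol_set_del // lcm_symbol_set -ord_genE.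
by split=> [[] //|le_j]; split=> //; apply/symbol_setP; exists j.
Qed.

(** The increasing enumeration of [C]. *)
Lemma symbol_of_set C : exists t (s : t.-tuple 'I_mu),
  (forall i j : 'I_t, (i < j)%N -> (tnth s i < tnth s j)%N) /\ symbol_set s = C.
Proof.
pose s := [seq i <- enum 'I_mu | g i \in C].
exists (size s), (in_tuple s); split=> [i j lt_ij|].
  have i0 : 'I_mu := tnth (in_tuple s) i; rewrite !(tnth_nth i0) /=.
  have sorted_s : sorted (fun i j : 'I_mu => (i < j)%N) s.
    apply: sorted_filter => [? ? ?|]; first exact: ltn_trans.
    have := iota_ltn_sorted 0 mu; rewrite -val_enum_ord sorted_map; exact.
  apply: (sorted_ltn_nth _ _ sorted_s); rewrite ?inE //.
  by move=> ? ? ?; apply: ltn_trans.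
apply/setP => u; have [i <-] := ranked_gen_surj u.
rewrite /symbol_set mem_imset; last exact: ranked_gen_inj.
by rewrite mem_filter mem_enum andbT.
Qed.

Lemma ord_gen_antichain i j : (m i <= m j)%MM -> i = j.
Proof. by move/antichain/ranked_gen_inj. Qed.

(** A subset of the symbol with minimum the [h]-th generator lies in the tail
    from position [h] on, so a generator breaking it violates admissibility at
    [h]; conversely a violation at [h] breaks that whole tail. *)
Lemma admissible_preserved t (s : t.-tuple 'I_mu) :
    (forall i j : 'I_t, (i < j)%N -> (tnth s i < tnth s j)%N) ->
  L_admissible m s <-> preserved lt (symbol_set s).
Proof.
move=> incr; have [irr _ _] := hlt; rewrite (L_admissibleP ord_gen_antichain).
split=> [[_ adm] D sDs [u [v [le_u minv lt_uv]]]|pres].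
  have /symbol_setP[h def_v] := subsetP sDs _ (proj1 minv).
  have [q def_u] := ranked_gen_surj u.
  suff /adm : (m q <= lcm_from m s h)%MM.
    by rewrite leqNgt -lt_ranked_gen def_u -def_v lt_uv.
  rewrite ord_genE def_u; apply: lepm_trans le_u _.
  apply/lcm_set_le => w wD; have /symbol_setP[k def_w] := subsetP sDs _ wD.
  rewrite def_w -ord_genE dvd_lcm_from // leqNgt; apply/negP => lt_kh.
  have lt_wv : lt w v by rewrite def_w def_v lt_ranked_gen incr.
  by have := below_min_notin hlt minv lt_wv; rewrite wD.
split=> // h q le_q; rewrite leqNgt -lt_ranked_gen; apply/negP => lt_q.
pose D := [set g (tnth s k) | k : 'I_t & (h <= k)%N].
apply: (pres D).
  by apply/subsetP => _ /imsetP[k _ ->]; apply/symbol_setP; exists k.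
exists (g q), (g (tnth s h)); split=> //.
  rewrite -ord_genE; apply: lepm_trans le_q _; rewrite lcm_from_le.
  apply/forallP => k; apply/implyP => le_hk; rewrite ord_genE dvd_lcm_set //.
  by apply/imsetP; exists k; rewrite ?inE.
split=> [|w]; first by apply/imsetP; exists h; rewrite ?inE.
case/imsetP => k; rewrite inE leq_eqVlt => /orP[/eqP/val_inj<- ->|lt_hk -> _].
  by rewrite eqxx.
by rewrite lt_ranked_gen incr.
Qed.

(** [L_minimalP] read through the dictionary between symbols and sets. *)
Lemma L_minimal_no_preserved_cover (K : fieldType) :
  L_minimal K m <-> forall u C, is_cover u C -> ~ preserved lt C.
Proof.
rewrite (L_minimalP K ord_gen_antichain).
split=> [irred u C coverC presC|no_cover].
  have [t [s [incr def_C]]] := symbol_of_set C; rewrite -def_C in coverC presC.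
  have /symbol_setP[j def_u] := coverC.1.
  case: t s j def_u incr presC coverC {def_C} => [|t] s j; first by case: j.
  move=> -> incr presC /(symbol_set_cover _ (increasing_inj incr)); apply/negP.
  exact/irred/admissible_preserved.
move=> t s j adm; apply/negP => le_j.
have /(L_admissibleP ord_gen_antichain)[incr _] := adm.
apply: (no_cover (g (tnth s j)) (symbol_set s)).
  exact/symbol_set_cover/le_j/increasing_inj.
exact/admissible_preserved.
Qed.

End OrderedGenerators.

(** * The five equivalent conditions *)
Theorem theorem3p14 (K : fieldType) (n : nat) (I : {mpoly K[n]} -> Prop)
    (G : {fset 'X_{1..n}}) (lt : rel G)
    (hI : monomial_ideal I)
    (hG : minimal_mon_generators I G)
    (hlt : strict_total_order lt) :
  [<->
    (* (i) *)
    L_minimal_free_resolution (ord_gen lt) I;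
    (* (ii) *)
    forall (u : G) (C : {set G}), is_cover u C -> ~ preserved lt C;
    (* (iii) *)
    forall (u : G) (C : {set G}), is_cover u C ->
      exists (D : {set G}) (v : G),
        [/\ D \subset C, v \notin D, is_cover v (v |: D)
          & min_lt lt (lcm_closure D :\: D) D];
    (* (iv) *)
    forall (u : G) (C : {set G}), E_minimal_cover u C -> ~ preserved lt C;
    (* (v) *)
    forall (u : G) (C : {set G}), E_minimal_cover u C ->
      exists (D : {set G}) (v : G),
        [/\ D \subset C, v \notin D, E_minimal_cover v (v |: D)
          & min_lt lt (lcm_closure D :\: D) D]].
Proof.
have antichain := minimal_generators_antichain hG.
have minP := L_minimal_no_preserved_cover hlt antichain K.
(* the sets required in (iii) and (v), from a broken subset of [C] *)
have witness C : ~ preserved lt C ->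
    exists (D : {set G}) (v : G), [/\ D \subset C, v \notin D,
      E_minimal_cover v (v |: D) & min_lt lt (lcm_closure D :\: D) D].
  move=> /not_preserved[D sDC /(broken_E_minimal hlt antichain)].
  case=> [D' [v [sD'D vD' minC /(broken_min_lt hlt)ltD']]].
  by exists D', v; split=> //; apply: subset_trans sDC.
tfae.
- by case=> _ /minP.
- move=> no_cover u C /no_cover/witness[D [v [sDC vD [cov _] ltD]]].
  by exists D, v.
- move=> wit u C [cov _] presC; have [D [v [sDC _ _ ltD]]] := wit u C cov.
  exact: presC sDC ((broken_min_lt hlt D).2 ltD).
- by move=> no_cover u C /no_cover/witness.
move=> wit; split.
  apply: (Lyubeznik_resolves (ord_gen_antichain antichain)) => f.
  rewrite (hG.1 f).
  have gens x : x \in G <-> exists i, x = ord_gen lt i.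
    split=> [xG|[i ->]]; last exact: fsvalP.
    have [i def_x] := ranked_gen_surj lt [` xG]%fset.
    by exists i; rewrite ord_genE def_x.
  by split=> -[N [c [a [a_gen def_f]]]]; exists N, c, a; split=> // i;
     have [x /gens x_gen ->] := a_gen i; exists x.
apply/minP => u C cov presC; have [C' sC'C minC'] := E_minimal_subcover cov.
have [D [v [sDC' _ _ ltD]]] := wit u C' minC'.
exact: presC (subset_trans sDC' sC'C) ((broken_min_lt hlt D).2 ltD).
Qed.
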